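(* Let $M\ge 2$ be an integer and let $F\colon X\to X$ be the twisted baker map on $X=[-1,1]\times[0,1]^{M-1}$. Then $F$ is non-uniformly expanding on periodic points; that is, for every non-empty open subset $U$ of $X$, $$\inf_{x}\chi(x)=1,$$ where the infimum is taken over all hyperbolic repelling periodic points $x$ of $F$ contained in $U$.
   Context: Let $M\ge2$ be an integer and $X=\{(x_1,\ldots,x_M)\in\mathbb R^M\colon -1\le x_1\le 1,\ 0\le x_j\le 1 \text{ for } j=2,\ldots,M\}$. Put $X_L=\{x\in X\colon x_1<0\}$ and $X_R=\{x\in X\colon x_1\ge 0\}$. The twisted baker map $F\colon X\to X$ is $$F(x_1,\ldots,x_M)=\begin{cases}(1+2x_1,x_2,\ldots,x_M) & \text{on } X_L,\\ (1-2x_M,x_1,\ldots,x_{M-1}) & \text{on } X_R.\end{cases}$$ A periodic point of $F$ of period $n$ means a fixed point of $F^n$. $JF^n(x)$ denotes the Jacobian matrix of $F^n$ at $x\in X$ with respect to the canonical basis of $\mathbb R^M$, and $\mathrm{spec}(JF^n(x))$ its set of (complex) eigenvalues. At boundary points of $X_L$ or $X_R$ derivatives are understood as one-sided derivatives: $JF(x)$ is the matrix of the linear part of the affine map defining $F$ on whichever of $X_L,X_R$ contains $x$, and $JF^n(x)=JF(F^{n-1}(x))\cdots JF(F(x))JF(x)$. A periodic point $x$ of period $n\ge1$ is hyperbolic repelling if $\mathrm{spec}(JF^n(x))$ does not intersect the closed unit disk $\{z\in\mathbb C\colon |z|\le 1\}$. For a hyperbolic repelling periodic point $x$ of period $\gamma(x)$,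 put $$\chi(x)=\min\left\{|\lambda|^{1/\gamma(x)}\colon \lambda\in\mathrm{spec}(JF^{\gamma(x)}(x))\right\},$$ a number strictly greater than $1$. *)

(* Defs.v *)
From HB Require Import structures.
From mathcomp Require Import all_boot all_order all_algebra.
From mathcomp Require Import all_classical all_reals all_analysis.
From mathcomp Require Import complex.
From mathcomp Require Import lra.

Set Implicit Arguments.
Unset Strict Implicit.
Unset Printing Implicit Defensive.

Import Order.TTheory GRing.Theory Num.Theory.
Import numFieldNormedType.Exports.

Local Open Scope classical_set_scope.
Local Open Scope ring_scope.

(* Throughout, M = m.+2, so that m ranging over nat is M >= 2.  Points of R^M *)
(* are column vectors; the coordinate x_j is the entry of 0-based index j - 1, *)
(* so that x_1 is [x ord0 0] and x_M is [x ord_max 0].                         *)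
Section TwistedBaker.
Context {R : realType} {m : nat}.
Implicit Types (x : 'cV[R]_m.+2) (n : nat).

Definition baker_space : set 'cV[R]_m.+2 :=
  [set x | -1 <= x ord0 0 <= 1 /\
           forall j : 'I_m.+2, j != ord0 -> 0 <= x j 0 <= 1].

Definition baker_left x : 'cV[R]_m.+2 :=
  \col_i (if i == ord0 then 1 + 2 * x ord0 0 else x i 0).

Definition baker_right x : 'cV[R]_m.+2 :=
  \col_i (if i == ord0 then 1 - 2 * x ord_max 0 else x (inord i.-1) 0).

Definition baker_branch x : 'cV[R]_m.+2 -> 'cV[R]_m.+2 :=
  if x ord0 0 < 0 then baker_left else baker_right.

(* Total extension of the twisted baker map; only its values on [baker_space], *)
(* which it preserves (lemma [baker_stable]), are meaningful.                  *)
Definition baker x : 'cV[R]_m.+2 := baker_branch x x.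

Lemma baker_stable x : baker_space x -> baker_space (baker x).
Proof.
rewrite /baker /baker_branch => -[/andP[x0l x0u] xj].
case: ifPn => [xneg|]; last rewrite -leNgt => xpos; split.
- by rewrite mxE eqxx; apply/andP; split; lra.
- by move=> j j0; rewrite mxE (negbTE j0); exact: xj.
- have /andP[? ?] : 0 <= x ord_max 0 <= 1 by exact: xj.
  by rewrite mxE eqxx; apply/andP; split; lra.
- move=> j j0; rewrite mxE (negbTE j0).
  have [->|] := eqVneq (inord j.-1 : 'I_m.+2) ord0; last exact: xj.
  by rewrite xpos x0u.
Qed.

(* Matrix, in the canonical basis, of the linear part v |-> f v - f 0 of an    *)
(* affine map f.                                                               *)
Definition linear_part_mx (f : 'cV[R]_m.+2 -> 'cV[R]_m.+2) : 'M[R]_m.+2 :=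
  \matrix_(i, j) (f (delta_mx j 0) - f 0) i 0.

Lemma baker_branch_affine x y z :
  baker_branch x z =
  baker_branch x y + linear_part_mx (baker_branch x) *m (z - y).
Proof.
have aff f : (forall (a b : R) u v, f (a *: u + b *: v) - f 0 =
    a *: (f u - f 0) + b *: (f v - f 0)) ->
    f z = f y + linear_part_mx f *m (z - y).
  move=> fl; pose g u := f u - f 0.
  have gl (a b : R) u v : g (a *: u + b *: v) = a *: g u + b *: g v by exact: fl.
  have g0 : g 0 = 0 by rewrite /g subrr.
  have gD u v : g (u + v) = g u + g v by have := gl 1 1 u v; rewrite !scale1r.
  have gZ a u : g (a *: u) = a *: g u.
    by have := gl a 0 u 0; rewrite g0 !scaler0 !addr0.
  have gE u : linear_part_mx f *m u = g u.
    rewrite [u in RHS]matrix_sum_delta (big_morph g gD g0).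
    apply/colP => i; rewrite mxE summxE; apply: eq_bigr => k _.
    by rewrite big_ord1 gZ !mxE mulrC.
  have -> : f z = g z + f 0 by rewrite /g subrK.
  have -> : f y = g y + f 0 by rewrite /g subrK.
  have -> : g z = g (z - y) + g y by rewrite -gD subrK.
  by rewrite gE -addrA [RHS]addrC.
apply: aff => a b u v; rewrite /baker_branch.
by case: ifP => _; apply/colP => i; rewrite !mxE; case: ifP => _; lra.
Qed.

Definition baker_jacobian x : 'M[R]_m.+2 := linear_part_mx (baker_branch x).

Fixpoint baker_jacobian_iter n x : 'M[R]_m.+2 :=
  if n is n'.+1 then
    baker_jacobian (iter n' baker x) *m baker_jacobian_iter n' x
  else 1%:M.

Definition spec (A : 'M[R]_m.+2) : set R[i] :=
  [set l | eigenvalue (map_mx (real_complex R) A) l].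

Definition hyperbolic_repelling n x : Prop :=
  [/\ (0 < n)%N, baker_space x, iter n baker x = x &
      spec (baker_jacobian_iter n x) `&` [set z | `|z| <= 1] = set0].

Definition spec_rates n x : set R :=
  [set complex.Re `|l| `^ n%:R^-1 | l in spec (baker_jacobian_iter n x)].

(* The infimum is a minimum (lemma [chi_min]).  The value does not depend on   *)
(* which period n of x is used.                                                *)
Definition chi n x : R := inf (spec_rates n x).

Lemma chi_min n x :
  spec_rates n x (chi n x) /\ lbound (spec_rates n x) (chi n x).
Proof.
pose A := map_mx (real_complex R) (baker_jacobian_iter n x).
pose f (l : R[i]) : R := complex.Re `|l| `^ n%:R^-1.
have [rs rsE] := closed_field_poly_normal (char_poly A).
have specE l : spec (baker_jacobian_iter n x) l <-> l \in rs.
  rewrite /spec /= eigenvalue_root_char rsE.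
  by rewrite (monicP (char_poly_monic A)) scale1r root_prod_XsubC.
have rs0 : rs != [::].
  apply/eqP => rs0; have := size_char_poly A.
  by rewrite rsE rs0 big_nil (monicP (char_poly_monic A)) scale1r size_poly1.
have [l0 l0rs l0P] : exists2 l, l \in rs & forall k, k \in rs -> f l <= f k.
  elim: rs rs0 {rsE specE} => // a [_ _|b rs IH _].
    by exists a; rewrite ?mem_head// => k; rewrite inE => /eqP ->.
  have [//|l lrs lP] := IH; have [al|la] := leP (f a) (f l).
    exists a; first exact: mem_head.
    by move=> k; rewrite inE => /predU1P[->//|/lP]; exact: le_trans.
  exists l; first by rewrite inE lrs orbT.
  by move=> k; rewrite inE => /predU1P[->|/lP//]; exact: ltW.
have lb : lbound (spec_rates n x) (f l0).
  by move=> _ [k /specE krs <-]; exact: l0P.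
have fl0 : spec_rates n x (f l0) by exists l0 => //; exact/specE.
suff -> : chi n x = f l0 by [].
apply/eqP; rewrite eq_le ge_inf//=; last by exists (f l0).
by apply: lb_le_inf => //; exists (f l0).
Qed.

End TwistedBaker.
Arguments baker_space : clear implicits.

(* Main.v *)
(** While the orbit of x stays in the unit cube between returns, F acts on the
coordinates as a queue: the last coordinate t leaves, and after k + 1 steps
(one right step, then k left steps) it re-enters in front as
s = 2^(k+1) (1 - t) - 1, where k is determined by t; the other coordinates are
shifted.  Hence the coordinates evolve independently, each under a piecewise
linear full-branch map of the interval whose inverse branches are
t = 1 - (1 + s) / 2^(k+1).  Choosing a finite word of branches for each
coordinate, all of the same length, gives a periodic point of F, whose Jacobian
over the period is diagonal with entries +-2^a, a being the sum of the k + 1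
along the word of that coordinate, while the period is the sum of all these a.
Words approximating a given point can be completed by one more letter, which is
0 for all coordinates except one, where it is a huge K: the period tends to
infinity with K while another coordinate keeps a fixed eigenvalue, so that chi
tends to 1.  Finally every point x of X is the image under the right branch of a
point y of the unit cube, and periodic points near y are sent near x. *)

Require Import Defs.
From mathcomp Require Import all_boot all_order all_algebra.
From mathcomp Require Import all_classical all_reals all_analysis.
From mathcomp Require Import complex ring lra zify.
Import Order.TTheory GRing.Theory Num.Theory.
Import numFieldNormedType.Exports.
Local Open Scope complex_scope.
Local Open Scope classical_set_scope.
Local Open Scope ring_scope.

(** * Inverse branches of the return map: coding, density and fixed points *)

Section InverseBranches.
Context {R : realType}.
Implicit Types (s t p : R) (k : nat) (w : seq nat).

(* Inverse branch of the first-return map of a coordinate to [0, 1], along one *)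
(* right step followed by k left steps.                                        *)
Definition branch k s : R := 1 - (1 + s) / 2 ^+ k.+1.

Lemma pow2_gt0 k : 0 < 2 ^+ k :> R.
Proof. by rewrite exprn_gt0. Qed.

Lemma pow2_ge0 k : 0 <= 2 ^+ k :> R.
Proof. exact: ltW (pow2_gt0 k). Qed.

Lemma pow2V_le_half k : 2 ^- k.+1 <= 2^-1 :> R.
Proof.
by rewrite lef_pV2 ?posrE ?pow2_gt0// exprS ler_peMr// exprn_ege1// ler1n.
Qed.

Lemma branch_itv k s : 0 <= s <= 1 -> 0 <= branch k s < 1.
Proof.
move=> /andP[s0 s1]; rewrite /branch.
have k0 := pow2_gt0 k.+1.
have k2 : 2 <= 2 ^+ k.+1 :> R by rewrite exprS ler_peMr// exprn_ege1// ler1n.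
have : 0 < (1 + s) / 2 ^+ k.+1 by apply: divr_gt0 => //; lra.
have : (1 + s) / 2 ^+ k.+1 <= 1 by rewrite ler_pdivrMr// mul1r; lra.
lra.
Qed.

Lemma foldr_branch_itv w s : 0 <= s <= 1 -> 0 <= foldr branch s w <= 1.
Proof.
move=> s01; elim: w => [//|k w IH] /=.
by have /andP[-> /ltW ->] := branch_itv k _ IH.
Qed.

Lemma branch_surj t : 0 <= t < 1 ->
  exists k, exists2 s, 0 <= s <= 1 & t = branch k s.
Proof.
move=> /andP[t0 t1].
have ex : exists n, 1 <= (1 - t) * 2 ^+ n.
  have [n nP] : exists n : nat, (1 - t)^-1 < n%:R.
    by exists (Num.truncn (1 - t)^-1).+1; exact: truncnS_gt.
  exists n; have nn : n%:R <= 2 ^+ n :> R.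
    by rewrite -natrX ler_nat ltnW// ltn_expl.
  rewrite -ler_pdivrMl ?subr_gt0// mulr1.
  by apply: (le_trans (ltW nP)).
(* The least [n] is 0 only for [t = 0], which is [branch 0 1]. Otherwise it is [k.+1]: the
   inequality at [k.+1] gives [0 <= s], its failure at [k] gives [s <= 1]. *)
case: (ex_minnP ex) => -[|k] kP kmin.
  have -> : t = 0 by move: kP; rewrite expr0; lra.
  by exists 0%N, 1; rewrite /branch ?ler01 ?lexx// expr1 divff ?subrr.
exists k, ((1 - t) * 2 ^+ k.+1 - 1); last first.
  by rewrite /branch addrCA subrr addr0 mulfK ?subKr// gt_eqF// pow2_gt0.
have : (1 - t) * 2 ^+ k < 1.
  by rewrite ltNge; apply/negP => /kmin; rewrite ltnn.
by move: kP; rewrite exprS mulrCA; lra.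
Qed.

Lemma branch_contract k s t : `|branch k s - branch k t| <= `|s - t| / 2.
Proof.
have -> : branch k s - branch k t = (t - s) / 2 ^+ k.+1 by rewrite /branch; ring.
rewrite normrM distrC ler_wpM2l//.
by rewrite ger0_norm ?invr_ge0 ?pow2_ge0// pow2V_le_half.
Qed.

(* The point 1 lies on no branch, being the limit of [branch k] as k grows, so *)
(* an expansion of t can only be approximate.                                  *)
Lemma branch_dense n t e : 0 <= t <= 1 -> 0 < e -> exists2 w, size w = n &
  forall s, 0 <= s <= 1 -> `|foldr branch s w - t| <= e + 2 ^- n.
Proof.
move=> t01 e0; elim: n t t01 => [|n IH] t /andP[t0 t1].
  exists [::] => // s /andP[s0 s1] /=.
  by rewrite expr0 invr1 ler_norml; apply/andP; split; lra.
have n0 : 0 < 2 ^- n :> R by rewrite invr_gt0 pow2_gt0.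
have n1 : 2 ^- n.+1 = 2 ^- n / 2 :> R by rewrite exprSr invfM mulrC.
have [tlt|tge] := ltP t 1.
  have [k [s0 s01 tE]] := branch_surj t (introT andP (conj t0 tlt)).
  have [w wn wP] := IH s0 s01.
  exists (k :: w) => [|s s01']/=; first by rewrite wn.
  rewrite tE (le_trans (branch_contract _ _ _))//.
  by have := wP s s01'; rewrite n1; lra.
have -> : t = 1 by lra.
(* A large first letter puts the whole image of [branch k] within [e] of 1; the zeros after it only
   pad the word to the required length. *)
have [k kP] : exists k : nat, e^-1 <= 2 ^+ k.
  exists (Num.truncn e^-1).+1; rewrite (le_trans (ltW (truncnS_gt _)))//.
  by rewrite -natrX ler_nat ltnW// ltn_expl.
exists (k :: nseq n 0%N) => [|s s01]; first by rewrite /= size_nseq.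
rewrite [foldr _ _ _]/=; set x := foldr _ _ _.
have /andP[x0 x1] : 0 <= x <= 1 by exact: foldr_branch_itv.
rewrite /branch addrAC subrr sub0r normrN ger0_norm; last first.
  by rewrite divr_ge0 ?pow2_ge0//; lra.
have : (1 + x) / 2 ^+ k.+1 <= e.
  rewrite ler_pdivrMr ?pow2_gt0// exprS mulrCA.
  by have : 1 <= e * 2 ^+ k; [rewrite -ler_pdivrMl// mulr1|lra].
lra.
Qed.

Lemma foldr_branch_affine w : exists a b : R,
  `|b| <= 2 ^- size w /\ forall s, foldr branch s w = a + b * s.
Proof.
elim: w => [|k w [a [b [bn ab]]]].
  by exists 0, 1; split=> [|s /=]; rewrite ?expr0 ?invr1 ?normr1// add0r mul1r.
exists (1 - (1 + a) / 2 ^+ k.+1), (- b / 2 ^+ k.+1); split=> [|s /=]; last first.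
  by rewrite ab /branch; ring.
have -> : 2 ^- size (k :: w) = 2 ^- size w / 2 :> R by rewrite exprS invfM mulrC.
rewrite normrM normrN.
by rewrite ler_pM// ger0_norm ?invr_ge0 ?pow2_ge0// pow2V_le_half.
Qed.

(** A nonempty word acts as [a + b * s] with [|b| <= 1/2], so [a / (1 - b)] is fixed. Strictness of
    [p < 1] is what later keeps the left steps in the open left half. *)
Lemma branch_fixpoint w : w != [::] -> exists2 p,
  0 <= p < 1 & foldr branch p w = p.
Proof.
case: w => // k w _.
have [a [b [bn ab]]] := foldr_branch_affine (k :: w).
have b1 : `|b| <= 1 / 2.
  by apply: (le_trans bn); rewrite mul1r pow2V_le_half.
move: b1; rewrite ler_norml => /andP[b1 b2].
have /andP[a0 a1] : 0 <= foldr branch 0 (k :: w) <= 1.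
  by apply: foldr_branch_itv; rewrite lexx ler01.
have /andP[c0 c1] : 0 <= foldr branch 1 (k :: w) <= 1.
  by apply: foldr_branch_itv; rewrite lexx ler01.
move: a0 a1 c0 c1; rewrite !ab mulr0 addr0 mulr1 => a0 a1 c0 c1.
have b1gt0 : 0 < 1 - b by lra.
pose p := a / (1 - b).
have pE : a + b * p = p by rewrite /p; field; rewrite gt_eqF.
have p01 : 0 <= p <= 1.
  by rewrite /p divr_ge0 ?(ltW b1gt0)//= ler_pdivrMr// mul1r; lra.
have fpE : foldr branch p (k :: w) = p by rewrite ab.
exists p => //; rewrite -fpE; apply: branch_itv.
exact: foldr_branch_itv.
Qed.

End InverseBranches.

(** * The baker map and its Jacobian as a queue of coordinates *)

Section ShiftRegister.
Context {R : realType} {m : nat}.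
Implicit Types (x v : 'cV[R]_m.+2) (u V : nat -> R) (k n : nat).

Lemma baker_jacobianE x v :
  baker_jacobian x *m v = baker_branch x v - baker_branch x 0.
Proof. by rewrite (baker_branch_affine x 0 v) subr0 addrC addKr. Qed.

Lemma baker_jacobian_left x v : x ord0 0 < 0 ->
  baker_jacobian x *m v = \col_i (if i == ord0 then 2 * v ord0 0 else v i 0).
Proof.
move=> x0; rewrite baker_jacobianE /baker_branch x0; apply/colP => i.
by rewrite !mxE; case: ifP => _; lra.
Qed.

Lemma baker_jacobian_right x v : 0 <= x ord0 0 ->
  baker_jacobian x *m v =
  \col_i (if i == ord0 then - (2 * v ord_max 0) else v (inord i.-1) 0).
Proof.
move=> x0; rewrite baker_jacobianE /baker_branch ltNge x0; apply/colP => i.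
by rewrite !mxE; case: ifP => _; lra.
Qed.

Lemma baker_jacobian_iterD a b x : baker_jacobian_iter (a + b) x =
  baker_jacobian_iter a (iter b baker x) *m baker_jacobian_iter b x.
Proof.
elim: a => [|a IH]; first by rewrite add0n mul1mx.
by rewrite addSn /= IH mulmxA iterD.
Qed.

(** The right step has slope -2, and each left step doubles the distance of the first coordinate to
    -1; at [i = k] that coordinate has become [s]. *)
Lemma baker_return k s x i : 0 <= x ord0 0 -> x ord_max 0 = branch k s ->
    0 <= s < 1 -> (i <= k)%N ->
  iter i.+1 baker x = \col_l (if l == ord0 then (1 + s) / 2 ^+ (k - i) - 1
                              else x (inord l.-1) 0) /\
  forall v, baker_jacobian_iter i.+1 x *m v =
    \col_l (if l == ord0 then - (2 ^+ i.+1 * v ord_max 0)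
            else v (inord l.-1) 0).
Proof.
move=> x0 xmax /andP[s0 s1]; elim: i => [_|i IH ik].
  split=> [|v]; last by rewrite /= mulmx1 baker_jacobian_right// expr1.
  rewrite /= /baker /baker_branch ltNge x0 subn0; apply/colP => l; rewrite !mxE.
  case: ifP => // _; rewrite xmax /branch exprS.
  by field; rewrite gt_eqF// pow2_gt0.
have [IHx IHJ] := IH (ltnW ik).
(* Here [k - i] is at least 1 and [s < 1], so [(1 + s) / 2 ^+ (k - i) < 1] and the next step is a
   left one. *)
have neg : iter i.+1 baker x ord0 0 < 0.
  rewrite IHx mxE eqxx subr_lt0 ltr_pdivrMr ?pow2_gt0// mul1r.
  rewrite (lt_le_trans (_ : _ < 2)) ?ltrD2l//.
  rewrite -[k](subnK ik) addnS -addSn addnK exprS ler_peMr//.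
  by rewrite exprn_ege1// ler1n.
split=> [|v].
  rewrite iterS {1}/baker /baker_branch neg; apply/colP => l.
  rewrite IHx !mxE eqxx; case: (l == ord0) => //.
  by rewrite subnS -(prednK (_ : 0 < k - i)%N) ?subn_gt0//= exprS; field;
    rewrite gt_eqF// pow2_gt0.
rewrite -[i.+2]add1n baker_jacobian_iterD -mulmxA IHJ.
rewrite [baker_jacobian_iter 1 _]mulmx1 baker_jacobian_left//; apply/colP => l.
by rewrite !mxE eqxx; case: (l == ord0) => //; rewrite [in RHS]exprS; ring.
Qed.

(* State i of the queue: [u i] is the next coordinate to leave, and it comes   *)
(* back as [u (i + m.+2)].                                                     *)
Definition queue u i : 'cV[R]_m.+2 := \col_l u (i + (m.+1 - l))%N.

Lemma queue_ord0 u i : queue u i ord0 0 = u (i + m.+1)%N.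
Proof. by rewrite mxE subn0. Qed.

Lemma queue_ord_max u i : queue u i ord_max 0 = u i.
Proof. by rewrite mxE subnn addn0. Qed.

Lemma queueS u i : queue u i.+1 =
  \col_l (if l == ord0 then u (i + m.+2)%N else queue u i (inord l.-1) 0).
Proof.
apply/colP => l; rewrite !mxE; case: eqVneq => [->|l0].
  by rewrite subn0 addSnnS.
have lgt : (0 < l)%N by rewrite lt0n.
rewrite inordK; last by have := ltn_ord l; lia.
by congr u; have := ltn_ord l; lia.
Qed.

(** Tangent vectors pass through the same queue: [V] obeys the linearized recursion, with slope
    [ds/dt = - 2 ^+ k.+1] from [t = branch k s]. *)
Lemma queue_return u i k : u i = branch k (u (i + m.+2)%N) ->
    (forall j, 0 <= u j < 1) ->
  iter k.+1 baker (queue u i) = queue u i.+1 /\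
  forall V, V (i + m.+2)%N = - (2 ^+ k.+1) * V i ->
    baker_jacobian_iter k.+1 (queue u i) *m queue V i = queue V i.+1.
Proof.
move=> uE u01.
have [||-> JE] := @baker_return k (u (i + m.+2)%N) (queue u i) k _ _ (u01 _)
  (leqnn k).
- by rewrite queue_ord0; have /andP[] := u01 (i + m.+1)%N.
- by rewrite queue_ord_max.
split=> [|V VE].
  rewrite queueS; apply/colP => l; rewrite !mxE; case: ifP => // _.
  by rewrite subnn expr0 divr1 addrC addKr.
rewrite JE queueS; apply/colP => l; rewrite !mxE; case: ifP => // _.
by rewrite subnn addn0 VE mulNr.
Qed.

Lemma queue_iter u (kap : nat -> nat) L :
    (forall i, (i < L)%N -> u i = branch (kap i) (u (i + m.+2)%N)) ->
    (forall j, 0 <= u j < 1) ->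
  let n := (\sum_(i < L) (kap i).+1)%N in
  iter n baker (queue u 0) = queue u L /\
  forall V, (forall i, (i < L)%N ->
      V (i + m.+2)%N = - (2 ^+ (kap i).+1) * V i) ->
    baker_jacobian_iter n (queue u 0) *m queue V 0 = queue V L.
Proof.
move=> + u01; elim: L => [_|L IH uE] /=.
  by rewrite big_ord0; split=> // V _; rewrite mul1mx.
have [i iL|IHx IHJ] := IH; first exact: uE (ltnW iL).
have [xE JE] := queue_return _ _ _ (uE L (ltnSn L)) u01.
rewrite big_ord_recr /= addnC; split=> [|V VE]; first by rewrite iterD IHx.
rewrite baker_jacobian_iterD IHx -mulmxA IHJ ?JE ?VE// => i iL.
exact: VE (ltnW iL).
Qed.

(** Queue index [i] is passage [i %/ m.+2] of slot [i %% m.+2], and consumes that letter of the word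
    of the slot. After [N] rounds all words are used up and every slot is back at its fixed
    point. *)
Lemma periodic_orbit (W : nat -> seq nat) (p : nat -> R) N :
    (forall r, size (W r) = N) -> (forall r, 0 <= p r < 1) ->
    (forall r, foldr branch (p r) (W r) = p r) ->
  let x : 'cV[R]_m.+2 := \col_l p (m.+1 - l)%N in
  let n :=
    (\sum_(i < N * m.+2) (nth 0 (W (i %% m.+2)) (i %/ m.+2)).+1)%N in
  iter n baker x = x /\
  baker_jacobian_iter n x =
    diag_mx (\row_l \prod_(k <- W (m.+1 - l)%N) - (2 ^+ k.+1)).
Proof.
move=> WN p01 pW x n.
(* Value of slot [r] after [q] of its returns. *)
pose s r q := foldr branch (p r) (drop q (W r)).
have s01 r q : 0 <= s r q < 1.
  rewrite /s; case: (drop q (W r)) => //= k w; apply: branch_itv.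
  by apply: foldr_branch_itv; have /andP[-> /ltW] := p01 r.
pose u i := s (i %% m.+2)%N (i %/ m.+2)%N.
pose kap i := nth 0%N (W (i %% m.+2)%N) (i %/ m.+2)%N.
have shift i :
    (((i + m.+2) %% m.+2 = i %% m.+2)%N *
     ((i + m.+2) %/ m.+2 = (i %/ m.+2).+1)%N)%type.
  by rewrite modnDr divnDr// divnn addn1.
have smallr (l : 'I_m.+2) : (m.+1 - l < m.+2)%N by rewrite ltnS leq_subr.
have q0 V : queue V 0 = \col_l V (m.+1 - l)%N by apply/colP => l; rewrite !mxE.
have divN i : (i < N * m.+2)%N -> (i %/ m.+2 < N)%N by rewrite ltn_divLR.
have xE : x = queue u 0.
  rewrite q0; apply/colP => l; rewrite !mxE /u modn_small// divn_small//.
  by rewrite /s drop0 pW.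
have uP i : (i < N * m.+2)%N -> u i = branch (kap i) (u (i + m.+2)%N).
  move=> /divN iN; rewrite /u !shift /s (drop_nth 0%N) ?WN//.
have [itx itJ] := queue_iter u kap (N * m.+2)%N uP (fun j => s01 _ _).
have last r : (r < m.+2)%N ->
    (((N * m.+2 + r) %% m.+2 = r)%N *
     ((N * m.+2 + r) %/ m.+2 = N)%N)%type.
  by move=> rm; rewrite modnMDl modn_small// divnMDl// divn_small// addn0.
split.
  rewrite xE itx q0; apply/colP => l; rewrite !mxE /u !last//.
  by rewrite modn_small// divn_small// /s drop0 pW drop_oversize ?WN.
pose D r q : R := \prod_(k <- take q (W r)) - (2 ^+ k.+1).
have JE v : baker_jacobian_iter n x *m v =
    diag_mx (\row_l \prod_(k <- W (m.+1 - l)%N) - (2 ^+ k.+1)) *m v.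
  (* Slots are numbered in order of exit, hence opposite to the coordinates. [V] multiplies the
     initial tangent entry by the slopes met so far. *)
  pose pos r : 'I_m.+2 := inord (m.+1 - r).
  pose V i := D (i %% m.+2)%N (i %/ m.+2)%N * v (pos (i %% m.+2)%N) 0.
  have posE (l : 'I_m.+2) : pos (m.+1 - l)%N = l.
    by rewrite /pos subKn ?inord_val// -ltnS.
  have -> : v = queue V 0.
    rewrite q0; apply/colP => l; rewrite !mxE /V modn_small// divn_small//.
    by rewrite /D take0 big_nil mul1r posE.
  rewrite xE itJ => [|i /divN iN].
    apply/colP => l; rewrite mul_diag_mx !mxE /V !last// add0n modn_small//.
    rewrite divn_small// {1}/D -{1}(WN (m.+1 - l)%N) take_size.
    by rewrite /D take0 big_nil mul1r.
  rewrite /V !shift /D (take_nth 0%N) ?WN// -cats1 big_cat big_seq1 /=.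
  by rewrite mulrA; congr (_ * _); rewrite mulrC.
apply/matrixP => i j.
by have /colP/(_ i) := JE (delta_mx j 0); rewrite -!colE !mxE.
Qed.

End ShiftRegister.

(** * Spectra along a periodic orbit and bounds on [chi] *)

Section Spectrum.
Context {R : realType} {m : nat}.
Implicit Types (x : 'cV[R]_m.+2) (A B P : 'M[R]_m.+2) (l : R[i]) (n : nat).

Lemma spec_diag (d : 'rV[R]_m.+2) l :
  spec (diag_mx d) l <-> exists j, l = (d 0 j)%:C.
Proof.
rewrite /spec /= map_diag_mx; split.
  move=> /eigenvalueP[v]; rewrite mul_mx_diag => /rowP vE v0.
  have [j vj] : exists j, v 0 j != 0.
    apply/existsP; apply: contraNT v0; rewrite negb_exists => /forallP v0.
    by apply/eqP/rowP => j; rewrite mxE; apply/eqP/negPn/v0.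
  exists j; apply/esym/(mulfI vj).
  by move: (vE j); rewrite !mxE => ->; rewrite mulrC.
move=> [j ->]; apply/eigenvalueP; exists (delta_mx 0 j).
  rewrite mul_mx_diag; apply/rowP => k; rewrite !mxE.
  rewrite eqxx; case: (eqVneq k j) => [->|_];
    by rewrite ?mulr1n ?mul1r ?mulr1 ?mulr0n ?mul0r ?mulr0.
by apply/eqP => /rowP/(_ j)/eqP; rewrite !mxE !eqxx oner_eq0.
Qed.

Lemma spec_similar P A B : P \in unitmx -> P *m A = B *m P -> spec A = spec B.
Proof.
have sub (Q C D : 'M[R]_m.+2) : Q \in unitmx -> Q *m C = D *m Q ->
    spec D `<=` spec C.
  move=> Qu QC l /eigenvalueP[v vD v0]; apply/eigenvalueP.
  exists (v *m map_mx (real_complex R) Q).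
    by rewrite -mulmxA -map_mxM QC map_mxM mulmxA vD scalemxAl.
  apply: contra_neq v0 => vQ.
  have QCu : map_mx (real_complex R) Q \in unitmx by rewrite map_unitmx.
  by rewrite -[v](mulmxK QCu) vQ mul0mx.
move=> Pu PA; apply/seteqP; split; last exact: sub PA.
apply: (sub (invmx P)); first by rewrite unitmx_inv.
by rewrite -[B](mulmxK Pu) -PA -mulmxA mulKmx.
Qed.

Lemma Re_norm_real (a : R) : complex.Re `|a%:C| = `|a|.
Proof. by rewrite normc_def /= expr0n addr0 sqrtr_sqr. Qed.

Lemma chi_ge1 n x : hyperbolic_repelling n x -> 1 <= chi n x.
Proof.
move=> [n0 _ _ hyp]; have [[l ll <-] _] := chi_min n x.
have l1 : 1 <= complex.Re `|l|.
  rewrite leNgt; apply/negP => /ltW l1.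
  suff : set0 l by [].
  rewrite -hyp; split=> //=.
  by move: l1; rewrite normc_def /= -lecR.
apply: (@le_trans _ _ (1 `^ n%:R^-1)); first by rewrite powR1.
by rewrite ge0_ler_powR ?nnegrE ?invr_ge0 ?(le_trans ler01 l1).
Qed.

Lemma chi_le n x (a e : R) : (0 < n)%N -> 0 <= e ->
    spec (baker_jacobian_iter n x) a%:C -> `|a| <= (1 + e) ^+ n ->
  chi n x <= 1 + e.
Proof.
move=> n0 e0 aspec ale; have [_ lb] := chi_min n x.
have e1 : 0 <= 1 + e by rewrite addr_ge0.
apply: (le_trans (lb _ (ex_intro2 _ _ _ aspec erefl))).
rewrite Re_norm_real.
have -> : 1 + e = ((1 + e) ^+ n) `^ n%:R^-1.
  by rewrite -powR_mulrn// -powRrM divff ?powRr1// pnatr_eq0 -lt0n.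
by rewrite ge0_ler_powR ?nnegrE ?invr_ge0 ?exprn_ge0.
Qed.

Lemma baker_jacobian_unit x : baker_jacobian x \in unitmx.
Proof.
rewrite -unitmx_tr -row_free_unit; apply: inj_row_free => v.
move=> /(congr1 trmx); rewrite trmx_mul trmxK trmx0 => Jv.
have [x0|x0] := ltP (x ord0 0) 0.
  move: Jv; rewrite baker_jacobian_left// => /colP Jv; apply/rowP => j.
  by have := Jv j; rewrite !mxE; case: eqVneq => [->|_//]; lra.
move: Jv; rewrite baker_jacobian_right// => /colP Jv; apply/rowP => j.
rewrite !mxE; have [->|jm] := eqVneq j ord_max.
  by have := Jv ord0; rewrite !mxE eqxx; lra.
have jlt : (j.+1 < m.+2)%N.
  rewrite ltn_neqAle ltn_ord andbT eqSS.
  by apply: contra_neq jm => jm; apply: val_inj.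
have := Jv (inord j.+1); rewrite !mxE -val_eqE /= inordK// inord_val.
by case: eqP.
Qed.

(** Both [JF^n(Fx) JF(x)] and [JF(x) JF^n(x)] equal [JF^(n+1)(x)], so the invertible [JF(x)]
    conjugates the two matrices. *)
Lemma baker_jacobian_iter_baker n x : iter n baker x = x ->
  spec (baker_jacobian_iter n (baker x)) = spec (baker_jacobian_iter n x).
Proof.
move=> nx; apply/esym/(spec_similar (baker_jacobian x)).
  exact: baker_jacobian_unit.
have := baker_jacobian_iterD n 1 x; rewrite addn1 /= nx mulmx1.
by [].
Qed.

Lemma hyperbolic_repelling_baker n x : hyperbolic_repelling n x ->
  hyperbolic_repelling n (baker x).
Proof.
move=> [n0 xX nx hyp]; split.
- exact: n0.
- exact: baker_stable.
- by rewrite -iterSr iterS nx.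
- by rewrite baker_jacobian_iter_baker.
Qed.

End Spectrum.

(** * Repelling periodic points with a slow direction, dense in the unit cube *)

Section Density.
Context {R : realType} {m : nat}.

Lemma norm_prod_slopes (w : seq nat) : w != [::] ->
  1 < `|\prod_(k <- w) - (2 ^+ k.+1 : R)|.
Proof.
have norm_slope k : 2 <= `|- (2 ^+ k.+1 : R)|.
  by rewrite normrN ger0_norm ?pow2_ge0// exprS ler_peMr// exprn_ege1// ler1n.
have ge1 v : 1 <= `|\prod_(k <- v) - (2 ^+ k.+1 : R)|.
  elim: v => [|k v IH]; first by rewrite big_nil normr1.
  by rewrite big_cons normrM; have := norm_slope k; nra.
case: w => // k w _; rewrite big_cons normrM.
by have := ge1 w; have := norm_slope k; nra.
Qed.

Lemma bernoulli_ineq (e : R) n : 0 <= e -> n%:R * e <= (1 + e) ^+ n.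
Proof.
move=> e0; elim: n => [|n IH]; first by rewrite mul0r ler01.
have : 1 <= (1 + e) ^+ n by rewrite exprn_ege1// lerDl.
rewrite exprS -natr1; nra.
Qed.

Lemma repelling_point_near (y : 'cV[R]_m.+2) (d e : R) :
    (forall l, 0 <= y l 0 <= 1) -> 0 < d -> 0 < e ->
  exists n x, [/\ hyperbolic_repelling n x, forall l, 0 <= x l 0 <= 1,
    forall l, `|x l 0 - y l 0| <= d &
    exists2 a : R, spec (baker_jacobian_iter n x) a%:C & `|a| <= (1 + e) ^+ n].
Proof.
move=> y01 d0 e0; have d2 : 0 < d / 2 by rewrite divr_gt0.
have [N NP] : exists N, 2 ^- N <= d / 2.
  exists (Num.truncn (d / 2)^-1).+1.
  rewrite -[leRHS]invrK lef_pV2 ?posrE ?pow2_gt0 ?invr_gt0//.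
  rewrite (le_trans (ltW (truncnS_gt _)))//.
  by rewrite -natrX ler_nat ltnW// ltn_expl.
pose t r := y (inord (m.+1 - r)) 0.
have wex r : exists w, size w = N /\
    forall s, 0 <= s <= 1 -> `|foldr branch s w - t r| <= d.
  have [w wN wP] := branch_dense N (t r) (d / 2) (y01 _) d2.
  exists w; split=> // s /wP /le_trans; apply; lra.
have [w wP] := choice wex.
(* The eigenvalue of slot 1 is fixed before [K], which enters only the word of slot 0. Then
   [|a| < K * e <= n * e <= (1 + e) ^+ n]. *)
pose a : R := \prod_(k <- rcons (w 1%N) 0%N) - (2 ^+ k.+1).
pose K := (Num.truncn (`|a| / e)).+1.
pose W r := rcons (w r) (if r == 0%N then K else 0%N).
have WN r : size (W r) = N.+1 by rewrite size_rcons (wP r).1.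
have Wn0 r : W r != [::] by rewrite -size_eq0 WN.
have pex r : exists p : R, 0 <= p < 1 /\ foldr branch p (W r) = p.
  by have [p p1 pW] := branch_fixpoint (R := R) _ (Wn0 r); exists p.
have [p pP] := choice pex.
have := @periodic_orbit R m W p N.+1 WN (fun r => (pP r).1) (fun r => (pP r).2).
set x : 'cV[R]_m.+2 := \col_l _; set n := (\sum_(i < _) _)%N.
move=> [itx itJ].
have x01 l : 0 <= x l 0 <= 1.
  by rewrite mxE; have [/andP[-> /ltW ->] _] := pP (m.+1 - l)%N.
(* Index [N * m.+2] is the last passage of slot 0, which alone adds [K.+1] to the period. *)
have Kn : (K < n)%N.
  have i0 : (N * m.+2 < N.+1 * m.+2)%N by rewrite ltn_mul2r/=.
  rewrite /n (bigD1 (Ordinal i0))//= modnMl mulnK// /W /=.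
  by rewrite nth_rcons (wP 0%N).1 ltnn eqxx leq_addr.
exists n, x; split=> //.
- split=> //; first exact: leq_ltn_trans Kn.
    split=> [|j _]; last exact: x01.
    by have /andP[x0 ->] := x01 ord0; rewrite (le_trans _ x0)// lerN10.
  rewrite itJ; apply/seteqP; split=> // l [/spec_diag[j ->]] /=.
  rewrite normc_def /= expr0n addr0 sqrtr_sqr lecR mxE leNgt.
  by rewrite norm_prod_slopes.
- move=> l; have [/andP[p0 /ltW p1] pW] := pP (m.+1 - l)%N.
  rewrite mxE -pW /W foldr_rcons.
  have -> : y l 0 = t (m.+1 - l)%N by rewrite /t subKn ?inord_val// -ltnS.
  (* The extra letter sends [p] into [0, 1], where the approximation by [w] is uniform. *)
  apply: (wP _).2; set k := (if _ then _ else _).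
  have /andP[-> /ltW ->//] :=
    branch_itv k (p (m.+1 - l)%N) (introT andP (conj p0 p1)).
exists a.
  rewrite itJ; apply/spec_diag; exists (inord m); rewrite mxE inordK//.
  by rewrite subSnn.
apply: (@le_trans _ _ (n%:R * e)); last by rewrite bernoulli_ineq// ltW.
rewrite -ler_pdivrMr// (le_trans (ltW (truncnS_gt _)))//.
by rewrite ler_nat ltnW.
Qed.

End Density.

Theorem theoremB (R : realType) (m : nat) (U : set 'cV[R]_m.+2) :
  U `<=` baker_space R m ->
  open (U : set (subspace (baker_space R m))) ->
  U !=set0 ->
  ereal_inf [set c | exists (n : nat) (x : 'cV[R]_m.+2),
    [/\ U x, hyperbolic_repelling n x & c = (chi n x)%:E]] = 1%E.
Proof.
move=> UX /open_subspaceP[V oV VU] [x Ux].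
have [Xx0 Xx] := UX _ Ux.
have [d d0 dV] : exists2 d : R, 0 < d & forall z : 'cV[R]_m.+2,
    (forall l, `|x l 0 - z l 0| < d) -> baker_space R m z -> U z.
  have [Vx _] : (V `&` baker_space R m) x by rewrite VU; split=> //; exact: UX.
  have /nbhs_ballP[d /= d0 dV] := open_nbhs_nbhs (conj oV Vx).
  exists d => // z xz Xz.
  suff [] : (U `&` baker_space R m) z by [].
  rewrite -VU; split=> //; apply: dV; split=> // i j.
  by rewrite (ord1 j); exact: xz.
(* [y] is the preimage of [x] under the right branch, whatever the sign of the *)
(* first coordinate of [x].                                                    *)
pose y : 'cV[R]_m.+2 :=
  \col_l (if l == ord_max then (1 - x ord0 0) / 2 else x (inord l.+1) 0).
have y01 l : 0 <= y l 0 <= 1.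
  rewrite mxE; case: eqVneq => [_|lm].
    by case/andP: Xx0 => *; apply/andP; split; lra.
  apply: Xx; rewrite -val_eqE /= inordK// ltnS.
  by have := ltn_ord l; move: lm; rewrite -val_eqE /=; lia.
(* The right branch at most doubles coordinate errors, so [d / 4] becomes at most [d / 2 < d]. *)
have near_U (z : 'cV[R]_m.+2) : (forall l, 0 <= z l 0 <= 1) ->
    (forall l, `|z l 0 - y l 0| <= d / 4) ->
    baker_space R m (baker z) -> U (baker z).
  move=> z01 zy; apply: dV => l.
  have /andP[z0 _] := z01 ord0.
  have -> : baker z = baker_right z by rewrite /baker /baker_branch ltNge z0.
  rewrite mxE; case: eqVneq => [->|l0].
    have := zy ord_max; rewrite mxE eqxx ler_norml ltr_norml => /andP[? ?].
    by apply/andP; split; lra.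
  have lgt : (0 < l)%N by rewrite lt0n.
  have := zy (inord l.-1); rewrite mxE -val_eqE /= inordK; last first.
    by have := ltn_ord l; lia.
  rewrite prednK// inord_val; case: eqP => [|_]; first by have := ltn_ord l; lia.
  by rewrite ler_norml ltr_norml => /andP[? ?]; apply/andP; split; lra.
apply/eqP; rewrite eq_le; apply/andP; split; last first.
  apply: le_ereal_inf_tmp => _ [n [z [_ hz ->]]].
  by rewrite lee_fin; exact: chi_ge1 hz.
apply/lee_addgt0Pr => e e0.
have d4 : 0 < d / 4 by rewrite divr_gt0.
have [n [z [hz z01 zy [a az ale]]]] := repelling_point_near y (d / 4) e y01 d4 e0.
have hFz := hyperbolic_repelling_baker n z hz.
have [n0 _ nz _] := hz; have [_ XFz _ _] := hFz.
apply: ge_ereal_inf; exists (chi n (baker z))%:E.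
  by exists n, (baker z); split=> //; exact: near_U.
rewrite -EFinD lee_fin; apply: chi_le n0 (ltW e0) _ ale.
by rewrite baker_jacobian_iter_baker.
Qed.
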